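(* For all real numbers $a,b>0$, writing $H=H(a,b)$, $G=G(a,b)$, $A=A(a,b)$, $S=S(a,b)$, $$H\le G\le \frac{2H+S}{3}\le \frac{A+H}{2}\le \frac{S+G}{2}\le \frac{H+2S}{3}\le A\le S+H-G\le S\le 3(A-G)+H.$$
   Context: For $a,b>0$ define the means $H(a,b)=\frac{2ab}{a+b}$, $G(a,b)=\sqrt{ab}$, $A(a,b)=\frac{a+b}{2}$, $S(a,b)=\sqrt{\frac{a^2+b^2}{2}}$. *)

(* Defs.v *)
From Stdlib Require Import Reals.
Local Open Scope R_scope.

Definition Hmean (a b : R) : R := 2 * a * b / (a + b).

Definition Gmean (a b : R) : R := sqrt (a * b).

Definition Amean (a b : R) : R := (a + b) / 2.

Definition Smean (a b : R) : R := sqrt ((a ^ 2 + b ^ 2) / 2).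

(* Main.v *)
Require Import Defs.
From Stdlib Require Import Reals Lra.
Local Open Scope R_scope.

(** The means [A] and [G] determine the other two: [A * H = G ^ 2] and
    [S ^ 2 = 2 * A ^ 2 - G ^ 2].  Dividing by [A] and putting [g = G / A],
    [s = S / A], the means [H, G, A, S] become [g ^ 2, g, 1, s] with
    [0 < g <= 1] and [s ^ 2 = 2 - g ^ 2], so the chain is a family of
    inequalities between [g] and [s] on an arc of a circle.  Each link is linear
    in [s]; [H <= G] and [S + H - G <= S] both say
    [g ^ 2 <= g], and, solved for [s], the others follow from four bounds:
    - [3 g - 2 g^2 <= s], which gives both
      [G <= (2H + S) / 3] and [(S + G) / 2 <= (H + 2S) / 3];
    - [2 s <= 3 - g^2], which gives both
      [(2H + S) / 3 <= (A + H) / 2] and [(H + 2S) / 3 <= A];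
    - [1 + g - g^2 <= s], which gives [A <= S + H - G], and also
      [(A + H) / 2 <= (S + G) / 2] because [g ^ 2 <= g];
    - [s <= 3 - 3 g + g^2], which gives [S <= 3 (A - G) + H].

    In each bound, squaring both sides and substituting [s ^ 2 = 2 - g ^ 2]
    leaves a polynomial in [g] that vanishes to order at least two at [g = 1]
    (the case [a = b]), with a cofactor that is nonnegative for [0 <= g <= 1]. *)

Lemma le_of_sqr_le (x y : R) : 0 <= y -> x ^ 2 <= y ^ 2 -> x <= y.
Proof.
intros hy hxy; apply Rsqr_incr_0_var; trivial.
now rewrite !Rsqr_pow2.
Qed.

(** On the arc, [s^2 - (3 g - 2 g^2)^2 = (1 - g)^2 (2 + 4 g (1 - g))]. *)
Lemma arc_lower_bound (g s : R) :
  0 <= g <= 1 -> 0 <= s -> s ^ 2 = 2 - g ^ 2 -> 3 * g - 2 * g ^ 2 <= s.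
Proof.
intros [g0 g1] s0 hs; apply le_of_sqr_le; trivial; rewrite hs.
assert (hg : 0 <= g * (1 - g)) by (apply Rmult_le_pos; lra).
assert (P : 0 <= (1 - g) ^ 2 * (2 + 4 * (g * (1 - g)))).
{ apply Rmult_le_pos; [apply pow2_ge_0 | lra]. }
lra.
Qed.

(** On the arc, [(3 - g^2)^2 - 4 s^2 = (1 - g^2)^2]. *)
Lemma arc_upper_bound (g s : R) :
  0 <= g <= 1 -> s ^ 2 = 2 - g ^ 2 -> 2 * s <= 3 - g ^ 2.
Proof.
intros [g0 g1] hs.
assert (hg : 0 <= g * (1 - g)) by (apply Rmult_le_pos; lra).
apply le_of_sqr_le; [lra |].
replace ((2 * s) ^ 2) with (4 * s ^ 2) by ring; rewrite hs.
assert (P := pow2_ge_0 (1 - g ^ 2)).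
lra.
Qed.

(** On the arc, [s^2 - (1 + g - g^2)^2 = (1 - g)^3 (1 + g)]: the two
    sides agree to second order at [g = 1], so this is the tightest link of the chain near [a = b]. *)
Lemma arc_lower_bound_osculating (g s : R) :
  0 <= g <= 1 -> 0 <= s -> s ^ 2 = 2 - g ^ 2 -> 1 + g - g ^ 2 <= s.
Proof.
intros [g0 g1] s0 hs; apply le_of_sqr_le; trivial; rewrite hs.
assert (P : 0 <= (1 - g) ^ 3 * (1 + g)).
{ apply Rmult_le_pos; [apply pow_le |]; lra. }
lra.
Qed.

(** On the arc, [(3 - 3 g + g^2)^2 - s^2 = (1 - g)^2 (3 + (2 - g)^2)]. *)
Lemma arc_upper_bound_quadratic (g s : R) :
  g <= 1 -> s ^ 2 = 2 - g ^ 2 -> s <= 3 - 3 * g + g ^ 2.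
Proof.
intros g1 hs; assert (hg := pow2_ge_0 g).
apply le_of_sqr_le; [lra |]; rewrite hs.
assert (P : 0 <= (1 - g) ^ 2 * (3 + (2 - g) ^ 2)).
{ apply Rmult_le_pos; [apply pow2_ge_0 |].
  assert (Q := pow2_ge_0 (2 - g)); lra. }
lra.
Qed.

Lemma means_normalized (a b : R) : 0 < a -> 0 < b ->
  exists g s : R,
    (0 <= g <= 1 /\ 0 <= s /\ s ^ 2 = 2 - g ^ 2) /\
    Hmean a b = Amean a b * g ^ 2 /\
    Gmean a b = Amean a b * g /\
    Smean a b = Amean a b * s.
Proof.
intros ha hb.
assert (hab : 0 < a * b) by now apply Rmult_lt_0_compat.
assert (hA : 0 < Amean a b) by (unfold Amean; lra).
assert (G0 : 0 <= Gmean a b) by apply sqrt_pos.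
assert (S0 : 0 <= Smean a b) by apply sqrt_pos.
assert (hG : Gmean a b ^ 2 = a * b) by (apply pow2_sqrt; lra).
assert (hS : Smean a b ^ 2 = (a ^ 2 + b ^ 2) / 2).
{ apply pow2_sqrt.
  assert (P := pow2_ge_0 a); assert (Q := pow2_ge_0 b); lra. }
assert (hGA : Gmean a b <= Amean a b).
{ apply le_of_sqr_le; [lra |]; rewrite hG; unfold Amean.
  assert (P := pow2_ge_0 (a - b)); lra. }
exists (Gmean a b / Amean a b), (Smean a b / Amean a b).
split; [split; [split | split] | split; [| split]].
- apply Rle_mult_inv_pos; lra.
- apply Rmult_le_reg_r with (Amean a b); trivial.
  unfold Rdiv; rewrite Rmult_assoc, Rinv_l; lra.
- apply Rle_mult_inv_pos; lra.
- unfold Rdiv; rewrite !Rpow_mult_distr, hG, hS.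
  unfold Amean; field; lra.
- unfold Rdiv; rewrite Rpow_mult_distr, hG.
  unfold Hmean, Amean; field; lra.
- field; lra.
- field; lra.
Qed.

Theorem corollary3p1 (a b : R) (ha : 0 < a) (hb : 0 < b) :
  let H := Hmean a b in
  let G := Gmean a b in
  let A := Amean a b in
  let S := Smean a b in
  H <= G /\
  G <= (2 * H + S) / 3 /\
  (2 * H + S) / 3 <= (A + H) / 2 /\
  (A + H) / 2 <= (S + G) / 2 /\
  (S + G) / 2 <= (H + 2 * S) / 3 /\
  (H + 2 * S) / 3 <= A /\
  A <= S + H - G /\
  S + H - G <= S /\
  S <= 3 * (A - G) + H.
Proof.
intros H G A S.
assert (hA : 0 < A) by (unfold A, Amean; lra).
destruct (means_normalized a b ha hb)
  as (g & s & (hg & hs & arc) & eH & eG & eS).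
fold H A in eH; fold G A in eG; fold S A in eS.
assert (scale : forall x y, x <= y -> A * x <= A * y).
{ intros x y; apply Rmult_le_compat_l; lra. }
assert (b0 : A * g ^ 2 <= A * g).
{ apply scale; assert (P : 0 <= g * (1 - g)) by (apply Rmult_le_pos; lra).
  lra. }
assert (b1 := scale _ _ (arc_lower_bound g s hg hs arc)).
assert (b2 := scale _ _ (arc_upper_bound g s hg arc)).
assert (b3 := scale _ _ (arc_lower_bound_osculating g s hg hs arc)).
assert (b4 := scale _ _ (arc_upper_bound_quadratic g s (proj2 hg) arc)).
rewrite eH, eG, eS.
repeat split; lra.
Qed.
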